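(* Let $n\ge 1$ be an integer and let $V(x)=\sum_{j=-2}^{n} a_j x^{j}$ with real coefficients satisfying $a_{-2}>0$, $a_0=0$ and $a_n>0$. Let $\tau\in\mathbb{R}$ with $\tau\neq 0$. Consider the eigenvalue problem $$-\psi''(x)+V(x)\,\psi(x)=E\,\psi(x),\qquad 0<x<\infty,\qquad \psi(0)=\psi(\infty)=0,$$ and the scaled eigenvalue problem obtained from it by the change of variable $x=\tau y$, namely $$-\widetilde\psi''(y)+\Big(\sum_{j=-2}^{n}\tau^{j+2}a_j\,y^{j}\Big)\widetilde\psi(y)=\widetilde E\,\widetilde\psi(y)\qquad\text{on } \{y\in\mathbb{R}:\ \tau y>0\},$$ with $\widetilde\psi$ vanishing at $y=0$ and at the infinite end of this half-line. Then the eigenvalues of the two problems correspond through $$E=\frac{\widetilde E}{\tau^{2}},$$ that is, $E$ is an eigenvalue of the original problem if and only if $\widetilde E=\tau^{2}E$ is an eigenvalue of the scaled problem.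
   Context: The notation $\psi(0)=\psi(\infty)=0$ means $\lim_{x\to0^+}\psi(x)=0$ and $\lim_{x\to\infty}\psi(x)=0$. An eigenvalue of such a problem is a number $E$ for which there is a nonzero, twice differentiable function $\psi$ on the open half-line satisfying the differential equation and the boundary conditions. In the scaled problem, the derivative is with respect to $y$, and eigenvalues are defined in the same way. *)

(* Defs.v *)
From Stdlib Require Import Reals ZArith.
From Coquelicot Require Import Coquelicot.
Open Scope R_scope.

(* [sum_{j=-2}^{n} a_j x^j]; the summation index is k = j + 2, running over 0, ..., n + 2. *)
Definition laurent_potential (n : nat) (a : Z -> R) (x : R) : R :=
  sum_f_R0 (fun k => a (Z.of_nat k - 2)%Z * powerRZ x (Z.of_nat k - 2)) (n + 2).

(* E is an eigenvalue of - psi'' + V psi = E psi on the open half-line D with end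
   points 0 and [infty] (an infinite element of [Rbar]), with psi vanishing at both
   ends. Eigenvalues and eigenfunctions may be complex; psi is a function of a real
   variable, so derivatives are those of maps from R to C seen as a real normed
   module. The values of psi outside the open set D play no role. *)
Definition is_eigenvalue (V : R -> R) (D : R -> Prop) (infty : Rbar) (E : C) : Prop :=
  exists psi psi1 psi2 : R -> C,
    (forall x, D x ->
       @is_derive R_AbsRing C_R_NormedModule psi x (psi1 x) /\
       @is_derive R_AbsRing C_R_NormedModule psi1 x (psi2 x) /\
       (- psi2 x + RtoC (V x) * psi x = E * psi x)%C) /\
    (exists x, D x /\ psi x <> RtoC 0) /\
    filterlim psi (within D (locally 0)) (locally (RtoC 0)) /\
    filterlim psi (Rbar_locally infty) (locally (RtoC 0)).

(* Main.v *)
Require Import Defs.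
From Stdlib Require Import Reals ZArith Lra.
From Coquelicot Require Import Coquelicot.
Open Scope R_scope.

(** If [psi] solves [- psi'' + V psi = E psi], then [y |-> psi (c y)] solves the
    equation with potential [c^2 V (c y)] and eigenvalue [c^2 E], because each
    differentiation brings out a factor [c]; and it vanishes at the ends of the
    half-line because dilation by [c] fixes [0] and carries one infinite end to
    the other ([is_eigenvalue_dilate], valid for any potential).  The scaled
    Laurent potential is precisely [tau^2 V (tau y)], the factor
    [tau^(j+2) = tau^2 tau^j] being what each monomial [x^j] contributes
    ([laurent_potential_scale]).  Since dilation by [/ tau] undoes dilation by
    [tau], the same lemma gives both directions of the equivalence. *)

Lemma is_derive_dilate (f : R -> C) (c y : R) (d : C) :
  @is_derive R_AbsRing C_R_NormedModule f (c * y) d ->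
  @is_derive R_AbsRing C_R_NormedModule (fun t => f (c * t)) y (RtoC c * d)%C.
Proof.
  intros Hf.
  rewrite <- scal_R_Cmult.
  apply (@is_derive_comp R_AbsRing C_R_NormedModule f (fun t => c * t)).
  - exact Hf.
  - auto_derive; [exact I | ring].
Qed.

Lemma is_derive_RtoC_mult (f : R -> C) (c y : R) (d : C) :
  @is_derive R_AbsRing C_R_NormedModule f y d ->
  @is_derive R_AbsRing C_R_NormedModule
    (fun t => RtoC c * f t)%C y (RtoC c * d)%C.
Proof.
  intros Hf.
  apply (@is_derive_ext R_AbsRing C_R_NormedModule (fun t => scal c (f t))).
  { intros t; apply scal_R_Cmult. }
  unfold is_derive.
  apply filterdiff_ext_lin with (fun t : R => scal c (scal t d : C_R_NormedModule)).
  - apply (@filterdiff_scal_r_fct R_AbsRing R_NormedModule C_R_NormedModule).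
    + apply locally_filter.
    + exact Rmult_comm.
    + exact Hf.
  - intros t.
    rewrite <- scal_R_Cmult, !scal_assoc.
    apply (f_equal (fun r : R => scal r d)), Rmult_comm.
Qed.

(** Dilations respect the eigenvalue problem for any potential.  Only an
    implication is stated, as the converse is the instance with [/ c] for [c]. *)
Lemma is_eigenvalue_dilate (V W : R -> R) (D D' : R -> Prop) (l l' : Rbar)
  (c : R) (E : C) :
  c <> 0 ->
  (forall y, D' y <-> D (c * y)) ->
  (forall y, D' y -> W y = c ^ 2 * V (c * y)) ->
  Rbar_mult c l' = l ->
  is_eigenvalue V D l E ->
  is_eigenvalue W D' l' (RtoC (c ^ 2) * E)%C.
Proof.
  intros Hc HD HW Hl (psi & psi1 & psi2 & Hode & (x0 & Hx0 & Hpsi0) & H0 & Hinf).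
  exists (fun y => psi (c * y)), (fun y => RtoC c * psi1 (c * y)%R)%C,
    (fun y => RtoC c * (RtoC c * psi2 (c * y)%R))%C.
  split; [| split; [| split]].
  - intros y Hy.
    destruct (Hode (c * y)) as (H1 & H2 & Heq); [now apply HD |].
    split; [now apply is_derive_dilate |].
    split; [now apply is_derive_RtoC_mult, is_derive_dilate |].
    rewrite (HW y Hy).
    replace (RtoC (c ^ 2)) with (RtoC c * RtoC c)%C
      by (rewrite <- RtoC_mult; f_equal; ring).
    replace (RtoC (c ^ 2 * V (c * y))) with (RtoC c * RtoC c * RtoC (V (c * y)%R))%C
      by (rewrite <- !RtoC_mult; f_equal; ring).
    rewrite <- (Cmult_assoc _ E), <- Heq.
    ring.
  - assert (Hx : c * (x0 / c) = x0) by (field; exact Hc).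
    exists (x0 / c).
    rewrite HD, Hx.
    now split.
  - apply filterlim_comp with (f := Rmult c) (2 := H0).
    intros P HP.
    pose proof (filterlim_Rbar_mult_l c (Finite 0)) as Hlim.
    replace (Rbar_mult c 0) with (Finite 0) in Hlim
      by (simpl; now rewrite Rmult_0_r).
    apply (@filter_imp R (locally 0) _ (fun y => D (c * y) -> P (c * y))).
    + intros y Hy HDy.
      now apply Hy, HD.
    + exact (Hlim _ HP).
  - apply filterlim_comp with (f := Rmult c) (2 := Hinf).
    rewrite <- Hl.
    apply filterlim_Rbar_mult_l.
Qed.

Lemma laurent_potential_scale (n : nat) (a : Z -> R) (tau y : R) :
  tau <> 0 ->
  laurent_potential n (fun j => powerRZ tau (j + 2) * a j) y
  = tau ^ 2 * laurent_potential n a (tau * y).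
Proof.
  intros Htau.
  unfold laurent_potential.
  rewrite scal_sum.
  apply sum_eq.
  intros k _.
  rewrite powerRZ_mult, powerRZ_add by exact Htau.
  change (powerRZ tau 2%Z) with (tau ^ 2).
  ring.
Qed.

Lemma Rbar_mult_pos_p_infty (c : R) : 0 < c -> Rbar_mult c p_infty = p_infty.
Proof.
  intros Hc; simpl.
  destruct (Rle_dec 0 c) as [Hle | Hle]; [| exfalso; lra].
  destruct (Rle_lt_or_eq_dec 0 c Hle); [reflexivity | exfalso; lra].
Qed.

Lemma Rbar_mult_neg_infty (c : R) :
  c < 0 -> Rbar_mult c p_infty = m_infty /\ Rbar_mult c m_infty = p_infty.
Proof.
  intros Hc; simpl.
  destruct (Rle_dec 0 c) as [Hle | _]; [exfalso; lra | now split].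
Qed.

Theorem corollary4p1 (n : nat) (a : Z -> R) (tau : R)
  (hn : (1 <= n)%nat)
  (ha_m2 : 0 < a (-2)%Z) (ha_0 : a 0%Z = 0) (ha_n : 0 < a (Z.of_nat n))
  (htau : tau <> 0) (E : C) :
  is_eigenvalue (laurent_potential n a) (fun x => 0 < x) p_infty E
  <->
  is_eigenvalue (laurent_potential n (fun j => powerRZ tau (j + 2) * a j))
    (fun y => 0 < tau * y) (if Rlt_dec 0 tau then p_infty else m_infty)
    (RtoC (tau ^ 2) * E)%C.
Proof.
  assert (Hinv : forall x, tau * (/ tau * x) = x) by (intros x; field; exact htau).
  split.
  - apply is_eigenvalue_dilate.
    + exact htau.
    + reflexivity.
    + intros y _; now apply laurent_potential_scale.
    + destruct (Rlt_dec 0 tau) as [Hpos | Hneg].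
      * now apply Rbar_mult_pos_p_infty.
      * apply Rbar_mult_neg_infty; lra.
  - intros H.
    replace E with (RtoC ((/ tau) ^ 2) * (RtoC (tau ^ 2) * E))%C.
    + revert H; apply is_eigenvalue_dilate.
      * now apply Rinv_neq_0_compat.
      * intros x; now rewrite Hinv.
      * intros x _.
        rewrite laurent_potential_scale, Hinv by exact htau.
        field; exact htau.
      * destruct (Rlt_dec 0 tau) as [Hpos | Hneg].
        -- now apply Rbar_mult_pos_p_infty, Rinv_0_lt_compat.
        -- apply Rbar_mult_neg_infty, Rinv_lt_0_compat; lra.
    + rewrite Cmult_assoc, <- RtoC_mult.
      replace ((/ tau) ^ 2 * tau ^ 2) with 1 by (field; exact htau).
      apply Cmult_1_l.
Qed.
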